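(* For all sufficiently large odd $n$, $$\hom(E_n,T(7,1,9)) < \hom(P_n,T(7,1,9)).$$ Further, for all sufficiently large $n$, odd or even, $$\hom(E_n,\widehat{T}(400,3,800)) < \hom(P_n,\widehat{T}(400,3,800)).$$ In other words, $T(7,1,9)$ is Leontovich at all sufficiently large odd $n$, and $\widehat{T}(400,3,800)$ is strongly Leontovich.
   Context: All graphs are finite. For a simple loopless graph $G$ and a target graph $H$ (possibly with loops, no multi-edges), an $H$-coloring of $G$ is a map $f:V(G)\to V(H)$ such that $f(x)$ and $f(y)$ are adjacent in $H$ whenever $x$ and $y$ are adjacent in $G$ (a looped vertex is adjacent to itself); $\hom(G,H)$ denotes the number of $H$-colorings of $G$. $P_n$ is the path on $n$ vertices. $E_n$ is the $n$-vertex tree obtained from $P_{n-1}$ (with vertices $v_1,\dots,v_{n-1}$ in path order) by adding one new vertex adjacent only to $v_{n-3}$, the third-from-last vertex of $P_{n-1}$. For positive integers $x,y,z$, $T(x,y,z)$ is the rooted tree in which the root has $x$ children, each child of the root has $y$ children, each grandchild of the root has $z$ children, and the great-grandchildren of the root have no children. It is regarded as an unrooted simple graph when used as a target. $\widehat{T}(x,y,z)$ is the graph obtained from $T(x,y,z)$ by adding a loop at the root. A graph $H$ is Leontovich at $n$ if there is a tree $T_n$ on $n$ vertices such that $\hom(T_n,H)<\hom(P_n,H)$. $H$ is strongly Leontovich if it is Leontovich at $n$ for all sufficiently large $n$. *)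

(* Defs.v *)
From mathcomp Require Import all_boot.

Set Implicit Arguments.
Unset Strict Implicit.
Unset Printing Implicit Defensive.

(* Finite graphs without multiple edges; loops are allowed. *)
Record graph := Graph {
  vertex :> finType;
  adj : rel vertex;
  adj_sym : symmetric adj }.

Record sgraph := SGraph {
  sgraph_graph :> graph;
  adj_irrefl : irreflexive (@adj sgraph_graph) }.

Definition coloring (G : sgraph) (H : graph) (f : {ffun G -> H}) : bool :=
  [forall x, forall y, adj x y ==> adj (f x) (f y)].

Definition hom (G : sgraph) (H : graph) : nat :=
  #|[set f : {ffun G -> H} | coloring f]|.

Definition sym_closure (V : Type) (r : rel V) : rel V :=
  [rel x y | r x y || r y x].

Lemma sym_closure_sym (V : Type) (r : rel V) : symmetric (sym_closure r).
Proof. by move=> x y; exact: orbC. Qed.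

Definition sym_graph (V : finType) (r : rel V) : graph :=
  Graph (sym_closure_sym r).

Lemma sym_graph_irrefl (V : finType) (r : rel V) :
  irreflexive r -> irreflexive (@adj (sym_graph r)).
Proof. by move=> r0 x; rewrite /adj /sym_graph /sym_closure /= !r0. Qed.

Definition path_arc (n : nat) : rel 'I_n := [rel i j : 'I_n | i.+1 == j].

Lemma path_arc_irrefl n : irreflexive (@path_arc n).
Proof. by move=> i; exact: gtn_eqF. Qed.

Definition path_graph (n : nat) : sgraph :=
  SGraph (sym_graph_irrefl (@path_arc_irrefl n)).

(* The path vertex v_k is encoded as k - 1, so v_1, ..., v_(n-1) are
   0, ..., n - 2 and v_(n-3) is n - 4; the added vertex is n - 1.
   Only n >= 4 is meaningful. *)
Definition E_arc (n : nat) : rel 'I_n :=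
  [rel i j : 'I_n | (i.+1 == j) && (j.+1 < n)
                  || (i + 4 == n) && (j.+1 == n)].

Lemma E_arc_irrefl n : irreflexive (@E_arc n).
Proof.
move=> i; rewrite /E_arc /= gtn_eqF //=; apply/negP => /andP[/eqP e4 /eqP e1].
by move/eqP: (etrans e4 (esym e1)); rewrite -[i.+1]addn1 eqn_add2l.
Qed.

Definition E_graph (n : nat) : sgraph :=
  SGraph (sym_graph_irrefl (@E_arc_irrefl n)).

(* A vertex is recorded by the choices of children made on the way down from
   the root: None is the root, Some (i, None) its i-th child,
   Some (i, Some (j, None)) a grandchild, and Some (i, Some (j, Some k)) a
   great-grandchild. *)
Definition T_vertex (x y z : nat) : finType :=
  option ('I_x * option ('I_y * option 'I_z)).

Definition T_parent (x y z : nat) : rel (T_vertex x y z) := fun u v =>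
  match u, v with
  | None, Some (_, None) => true
  | Some (i, None), Some (i', Some (_, None)) => i == i'
  | Some (i, Some (j, None)), Some (i', Some (j', Some _)) =>
      (i == i') && (j == j')
  | _, _ => false
  end.

Definition T_graph (x y z : nat) : graph := sym_graph (@T_parent x y z).

Definition That_parent (x y z : nat) : rel (T_vertex x y z) :=
  [rel u v | T_parent u v || (u == None) && (v == None)].

Definition That_graph (x y z : nat) : graph := sym_graph (@That_parent x y z).

Definition connected (G : graph) : Prop :=
  forall x y : G, connect (@adj G) x y.

(* ucycle includes the requirement that the vertices be distinct. *)
Definition acyclic (G : graph) : Prop :=
  forall s : seq G, 2 < size s -> ~ ucycle (@adj G) s.

Definition is_tree (G : sgraph) : Prop :=
  [/\ 0 < #|G|, connected G & acyclic G].

Definition Leontovich_at (H : graph) (n : nat) : Prop :=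
  exists G : sgraph,
    [/\ is_tree G, #|G| = n & hom G H < hom (path_graph n) H].

Definition strongly_Leontovich (H : graph) : Prop :=
  exists N : nat, forall n : nat, N <= n -> Leontovich_at H n.

(* Main.v *)
(* Deleting the three vertices of E_n (resp. P_n) beyond v_(n-3) gives the path
   P_(n-3), and hom(P_n,H) - hom(E_n,H) is the sum over v in V(H) of
   w(v) (W_3(v) - W_1(v) W_2(v)), where W_k(v) counts the walks with k edges
   starting at v and w = W_(n-4).  For H = T(x,y,z), with or without a loop at
   the root, walk counts depend only on the level of v, so the gap is f(A^(n-4) 1)
   for a linear form f and a nonnegative 4x4 matrix A.  For T(7,1,9) the values at
   odd exponents satisfy a two-term recurrence and are eventually positive.  For
   the looped tree the form f A^m has positive coefficients for one suitable m,
   certified in integer arithmetic with downward rounding; since A is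
   nonnegative, the gap is then positive for all exponents at least m. *)
From Stdlib Require Import ZArith.
Require Import Defs.
From mathcomp Require Import all_boot zify.

Set Implicit Arguments.
Unset Strict Implicit.
Unset Printing Implicit Defensive.

(** * Trees given by arcs from smaller to larger labels *)

Lemma sym_graph_connected n (r : rel 'I_n.+1) :
  (forall i j, r i j -> i < j) -> (forall j, j != ord0 -> exists i, r i j) ->
  connected (sym_graph r).
Proof.
move=> r_lt r_ex.
have sc : connect_sym (@adj (sym_graph r)).
  by apply: sym_connect_sym => u v; exact: adj_sym.
(* Each nonzero vertex has a smaller neighbour, so descending leads to [ord0]; [m] bounds the label
   for the induction. *)
have to0 m (j : 'I_n.+1) : j <= m -> connect (@adj (sym_graph r)) j ord0.
  elim: m j => [|m IHm] j jm; have [->|/r_ex[i rij]] := eqVneq j ord0;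
    try exact: connect0; have ij := r_lt _ _ rij.
    by move: (leq_trans ij jm).
  apply: (@connect_trans _ _ i).
    by apply: connect1; apply/orP; right.
  by apply: IHm; rewrite -ltnS (leq_trans ij jm).
by move=> i j; apply: (connect_trans (to0 _ _ (leqnn i))); rewrite sc (to0 j).
Qed.

(* The largest vertex of a cycle would have two distinct smaller neighbours. *)
Lemma sym_graph_acyclic n (r : rel 'I_n) :
  (forall i j, r i j -> i < j) ->
  (forall i i' j, r i j -> r i' j -> i = i') -> acyclic (sym_graph r).
Proof.
move=> r_lt r_inj [|x0 s0] // s2 cyc.
have [x xs xmax] := arg_maxnP (fun i : 'I_n => val i) (mem_head x0 s0).
(* With the cycle rotated to start at its maximum [x], the neighbours of [x] are the second vertex
   [y] and the last vertex [z]. *)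
have [k s E] := rot_to xs.
have sz : size (x :: s) = size (x0 :: s0) by rewrite -E size_rot.
have lex u : u \in x :: s -> u <= x by rewrite -E mem_rot => /xmax.
have {cyc} : ucycle (@adj (sym_graph r)) (x :: s) by rewrite -E rot_ucycle.
case: s => [|y s] in lex sz E *; first by rewrite -sz in s2.
case/lastP: s => [|s z] in lex sz E *; first by rewrite -sz in s2.
case/andP; rewrite /= rcons_path last_rcons => /andP[xy /andP[_ zx]] /and3P[_ yz _].
have lower u : u \in x :: y :: rcons s z -> r x u || r u x -> r u x.
  by move=> /lex ux /orP[/r_lt|//]; rewrite ltnNge ux.
have ry := lower y; have rz := lower z.
have /r_inj/(_ (rz _ _)) yEz : r y x by apply: ry => //; rewrite !inE eqxx orbT.
rewrite yEz ?mem_rcons ?mem_head //  in yz.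
  by rewrite !inE mem_rcons mem_head !orbT.
by rewrite orbC.
Qed.

Lemma E_graph_tree n : is_tree (E_graph n.+4).
Proof.
have lt (i j : 'I_n.+4) : E_arc i j -> i < j.
  by case/orP=> /andP[/eqP E1]; [rewrite -E1 | move/eqP=> E2; lia].
split; first by rewrite card_ord.
- apply: sym_graph_connected => // j j0.
  have {}j0 : 0 < j by rewrite lt0n.
  have [jl|jl] := ltnP j.+1 n.+4.
    have jp : j.-1 < n.+4 by lia.
    by exists (inord j.-1); rewrite /E_arc /= inordK // prednK // eqxx jl.
  have jE : j.+1 = n.+4 by apply/eqP; rewrite eqn_leq jl andbT.
  exists (inord n); rewrite /E_arc /= inordK; last by lia.
  by apply/orP; right; apply/andP; split; apply/eqP; lia.
- apply: sym_graph_acyclic => // i i' j; rewrite /E_arc /=.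
  by case/orP=> /andP[/eqP a b]; case/orP=> /andP[/eqP c d]; apply/val_inj => /=; lia.
Qed.

(** * Walk counts and the adjacency operator *)

Definition nbsum (H : graph) (F : H -> nat) (v : H) : nat :=
  \sum_(u | adj v u) F u.

Definition walks (H : graph) (k : nat) : H -> nat :=
  iter k (@nbsum H) (fun=> 1).

Arguments walks : simpl never.

(** Symmetry of [adj] makes the adjacency operator self-adjoint, so walk steps can be moved from one
    factor to the other. *)
Lemma nbsum_adjoint (H : graph) (F G : H -> nat) :
  \sum_v nbsum F v * G v = \sum_v F v * nbsum G v.
Proof.
under eq_bigr do rewrite big_distrl /=.
under [RHS]eq_bigr do rewrite big_distrr /=.
rewrite (exchange_big_dep xpredT) //=.
by apply: eq_bigr => u _; apply: eq_bigl => v; rewrite adj_sym.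
Qed.

Lemma sum_walks_iter (H : graph) k (F : H -> nat) :
  \sum_v walks k v * F v = \sum_v iter k (@nbsum H) F v.
Proof.
elim: k F => [|k IHk] F /=; first by under eq_bigr do rewrite mul1n.
by rewrite /walks /= nbsum_adjoint IHk -iterS iterSr.
Qed.

(** * Colorings as tuples of colours, and homomorphism counts as walk sums *)

Lemma sum_tuple_cons (V : finType) n (F : n.+1.-tuple V -> nat) :
  \sum_t F t = \sum_x \sum_(t : n.-tuple V) F [tuple of x :: t].
Proof.
rewrite pair_bigA /=; apply: reindex.
exists (fun t : n.+1.-tuple V => (thead t, [tuple of behead t])) => t _ /=.
  by case: t => x t; congr pair; apply/val_inj.
by rewrite -tuple_eta.
Qed.

Lemma nbsumE (H : graph) (F : H -> nat) v :
  nbsum F v = \sum_u adj v u * F u.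
Proof.
by rewrite /nbsum big_mkcond; apply: eq_bigr => u _; case: adj; rewrite ?mul1n.
Qed.

Lemma walksS (H : graph) k (v : H) :
  walks k.+1 v = \sum_u adj v u * walks k u.
Proof. exact: nbsumE. Qed.

(** A tuple sorted for [adj] is a walk. Summing out its head replaces [F] by [nbsum F], and
    self-adjointness turns this into one more step of [walks]. *)
Lemma sum_sorted (H : graph) n (F : H -> nat) :
  \sum_(t : n.+1.-tuple H) sorted (@adj H) t * F (thead t) =
  \sum_v walks n v * F v.
Proof.
elim: n F => [|n IHn] F; rewrite sum_tuple_cons.
  apply: eq_bigr => x _; rewrite (big_pred1 [tuple]) => [|t]; last first.
    by apply/esym/eqP; exact: tuple0.
  by rewrite theadE.
rewrite exchange_big /= /walks /= nbsum_adjoint -/(walks n) -IHn.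
apply: eq_bigr => t _; rewrite nbsumE big_distrr; apply: eq_bigr => x _ /=.
by case/tupleP: t => y t; rewrite !theadE /= adj_sym -mulnb; lia.
Qed.

(* Colours are listed from the last vertex of 'I_n down, so that pendant
   vertices with large labels sit at the head of the tuple. *)
Lemma hom_tuple (H : graph) n (r : rel 'I_n) (r0 : irreflexive r) :
  hom (SGraph (sym_graph_irrefl r0)) H =
  \sum_(t : n.-tuple H)
    [forall i, forall j, r i j ==> adj (tnth t (rev_ord i)) (tnth t (rev_ord j))].
Proof.
rewrite /hom cardsE -sum1_card big_mkcond.
transitivity (\sum_(f : {ffun 'I_n -> H})
    (coloring (G := SGraph (sym_graph_irrefl r0)) f : nat)).
  by apply: eq_bigr.
rewrite (reindex (fun t : n.-tuple H => [ffun i => tnth t (rev_ord i)])).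
  apply: eq_bigr => t _; set b := coloring _.
  suff -> : b = [forall i, forall j, r i j ==>
      adj (tnth t (rev_ord i)) (tnth t (rev_ord j))] by [].
  apply/forallP/forallP => h i; apply/forallP => j; apply/implyP.
    by move=> rij; move/forallP/(_ j)/implyP: (h i); rewrite !ffunE; apply; apply/orP; left.
  rewrite !ffunE => /orP[] rij.
    by move/forallP/(_ j)/implyP: (h i); apply.
  by rewrite adj_sym; move/forallP/(_ i)/implyP: (h j); apply.
exists (fun f : {ffun 'I_n -> H} => [tuple f (rev_ord i) | i < n]) => [t|f] _.
  by apply: eq_from_tnth => i; rewrite tnth_mktuple ffunE rev_ordK.
by apply/ffunP => i; rewrite ffunE tnth_mktuple rev_ordK.
Qed.

Lemma hom_path (H : graph) n :
  hom (path_graph n.+1) H = \sum_(v : H) walks n v.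
Proof.
under [RHS]eq_bigr do rewrite -[walks _ _]muln1.
rewrite -sum_sorted hom_tuple; apply: eq_bigr => t _; rewrite muln1; congr nat_of_bool.
have nE i : tnth t i = nth (thead t) t i by exact: tnth_nth.
(* Position [i] of [t] holds the colour of vertex [n - i], so arcs are traversed backwards. *)
apply/forallP/(sortedP (thead t)) => [h i|h i].
  rewrite size_tuple => ltin.
  move/forallP/(_ (inord (n - i)))/implyP: (h (inord (n - i.+1))); rewrite !nE /= !inordK; try lia.
  have -> : n.+1 - (n - i.+1).+1 = i.+1 by lia.
  have -> : n.+1 - (n - i).+1 = i by lia.
  by rewrite adj_sym; apply; rewrite /path_arc /= !inordK; lia.
apply/forallP => j; apply/implyP => /eqP ij; rewrite !nE /= adj_sym.
have -> : n.+1 - i.+1 = (n.+1 - j.+1).+1 by have := ltn_ord j; lia.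
by apply: h; rewrite size_tuple; have := ltn_ord j; lia.
Qed.

Lemma hom_E (H : graph) n :
  hom (E_graph n.+4) H = \sum_(v : H) walks n v * (walks 1 v * walks 2 v).
Proof.
rewrite hom_tuple sum_tuple_cons.
(* In the reversed listing [x] colours the pendant vertex and [t] colours the path from its last
   vertex down, so index 2 of [t] is the attachment vertex. *)
have cond x (t : n.+3.-tuple H) : [forall i, forall j, E_arc i j ==>
      adj (tnth [tuple of x :: t] (rev_ord i)) (tnth [tuple of x :: t] (rev_ord j))]
    = adj x (nth x t 2) && sorted (@adj H) t.
  have nE i : tnth [tuple of x :: t] i = nth x (x :: t) i by exact: tnth_nth.
  apply/forallP/andP => [h|[h2 /(sortedP x) h] i]; last first.
    apply/forallP => j; apply/implyP => /orP[]/andP[/eqP ij jl]; rewrite !nE /=.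
      rewrite adj_sym.
      have -> : n.+4 - i.+1 = (n.+2 - j).+2 by lia.
      have -> : n.+4 - j.+1 = (n.+2 - j).+1 by lia.
      by apply: h; rewrite size_tuple; have := ltn_ord j; lia.
    have -> : n.+4 - i.+1 = 3 by lia.
    have -> : n.+4 - j.+1 = 0 by move/eqP: jl; lia.
    by rewrite adj_sym.
  split.
    move/forallP/(_ (inord n.+3))/implyP: (h (inord n)); rewrite !nE /= !inordK; try lia.
    have -> : n.+4 - n.+1 = 3 by lia.
    have -> : n.+4 - n.+4 = 0 by lia.
    by rewrite adj_sym; apply; rewrite /E_arc /= !inordK; lia.
  apply/(sortedP x) => i; rewrite size_tuple => li.
  move/forallP/(_ (inord (n.+2 - i)))/implyP: (h (inord (n.+1 - i))).
  rewrite !nE /= !inordK; try lia.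
  have -> : n.+4 - (n.+1 - i).+1 = i.+2 by lia.
  have -> : n.+4 - (n.+2 - i).+1 = i.+1 by lia.
  by rewrite adj_sym; apply; rewrite /E_arc /= !inordK; lia.
under eq_bigr => x _ do under eq_bigr => t _ do rewrite cond -mulnb.
rewrite exchange_big /= sum_tuple_cons exchange_big.
(* Summing out the pendant vertex and the path's last vertex gives two factors [walks 1]; the
   attachment vertex now has index 1. Summing out one more vertex turns the second factor into
   [walks 2]. *)
transitivity (\sum_(t : n.+2.-tuple H)
    walks 1 (nth (thead t) t 1) * (sorted (@adj H) t * walks 1 (thead t))).
  apply: eq_bigr => t _; rewrite [walks 1 (thead t)]walksS !big_distrr.
  apply: eq_bigr => y _ /=; rewrite -big_distrl /=.
  case/tupleP: t => z t; case/tupleP: t => u t; rewrite theadE /= walksS.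
  under [in RHS]eq_bigr do rewrite muln1 adj_sym.
  by rewrite -[walks 0 y]/1 -!mulnb (adj_sym z y); lia.
rewrite sum_tuple_cons exchange_big /= -sum_sorted; apply: eq_bigr => t _.
rewrite [walks 2 _]walksS !big_distrr; apply: eq_bigr => z _ /=.
by case/tupleP: t => u t; rewrite /= !theadE -!mulnb (adj_sym u z); lia.
Qed.

(** * Reduction of walk counts on the targets to four levels *)

Lemma sum_option (T : finType) (F : option T -> nat) :
  \sum_o F o = F None + \sum_x F (Some x).
Proof.
rewrite (bigD1 None) //=; congr addn.
rewrite (reindex_omap Some id) => [|[x|]] //=.
by apply: eq_bigl => x; rewrite eqxx.
Qed.

Lemma sum_pair (S T : finType) (F : S * T -> nat) :
  \sum_p F p = \sum_a \sum_b F (a, b).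
Proof. by rewrite pair_bigA; apply: eq_bigr => -[]. Qed.

Lemma sum_T_vertex x y z (F : T_vertex x y z -> nat) :
  \sum_v F v = F None + \sum_(i < x) (F (Some (i, None)) +
    \sum_(j < y) (F (Some (i, Some (j, None))) +
      \sum_(k < z) F (Some (i, Some (j, Some k))))).
Proof.
rewrite sum_option sum_pair; congr addn.
apply: eq_bigr => i _; rewrite sum_option sum_pair; congr addn.
by apply: eq_bigr => j _; rewrite sum_option.
Qed.

Definition level_fun x y z (q : nat * nat * nat * nat) (v : T_vertex x y z) : nat :=
  let '(a, b, c, d) := q in
  match v with
  | None => a
  | Some (_, None) => b
  | Some (_, Some (_, None)) => c
  | Some (_, Some (_, Some _)) => d
  end.

Lemma sum_level_fun x y z a b c d :
  \sum_(v : T_vertex x y z) level_fun (a, b, c, d) v =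
  a + x * b + x * y * c + x * y * z * d.
Proof.
rewrite sum_T_vertex /=.
under eq_bigr do under eq_bigr do rewrite sum_nat_const card_ord.
under eq_bigr do rewrite sum_nat_const card_ord.
by rewrite sum_nat_const card_ord; lia.
Qed.

Lemma sum_eq_ord n (i : 'I_n) c : \sum_(j < n) (i == j) * c = c.
Proof.
rewrite (bigD1 i) //= eqxx mul1n big1 ?addn0 // => j ji.
by rewrite eq_sym (negPf ji).
Qed.

(** The neighbours of a vertex are its parent and its children, so functions constant on levels are
    stable under [nbsum], which acts on them as a 4x4 matrix. *)
Lemma nbsum_T x y z a b c d (v : T_graph x y z) :
  nbsum (H := T_graph x y z) (@level_fun x y z (a, b, c, d)) v =
  @level_fun x y z (x * b, a + y * c, b + z * d, c) v.
Proof.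
rewrite nbsumE sum_T_vertex.
case: v => [[i [[j [k|]]|]]|] /=.
- rewrite add0n -[RHS](sum_eq_ord i); apply: eq_bigr => i0 _.
  rewrite -[in RHS](sum_eq_ord j c) big_distrr /=; apply: eq_bigr => j0 _.
  by rewrite big1 // addn0 /sym_closure /= (eq_sym i0) (eq_sym j0) mulnA mulnb.
- rewrite add0n big_split /=; congr addn.
    rewrite -[RHS](sum_eq_ord i); apply: eq_bigr => i0 _.
    by rewrite /sym_closure /= eq_sym.
  rewrite -[RHS](sum_eq_ord i); apply: eq_bigr => i0 _.
  rewrite -[in RHS](sum_eq_ord j (z * d)) big_distrr /=; apply: eq_bigr => j0 _.
  by rewrite add0n /sym_closure /= sum_nat_const card_ord orbF -mulnb mulnCA -!mulnA.
- rewrite mul1n; congr addn; rewrite -[RHS](sum_eq_ord i); apply: eq_bigr => i0 _.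
  rewrite add0n /sym_closure /= big_split /= !sum_nat_const !card_ord.
  by rewrite orbF mul0n !muln0 addn0 mulnCA.
- rewrite add0n big_split /= sum_nat_const card_ord mul1n.
  by rewrite [X in _ + X]big1 ?addn0 // => i _; apply: big1 => j _; rewrite big1.
Qed.

Lemma nbsum_That x y z a b c d (v : That_graph x y z) :
  nbsum (H := That_graph x y z) (@level_fun x y z (a, b, c, d)) v =
  @level_fun x y z (a + x * b, a + y * c, b + z * d, c) v.
Proof.
(* The loop adds only the pair (root, root), so only the value at the root changes, by [a]. *)
have adjE u : adj v u =
    @adj (T_graph x y z) v u || (v == None :> T_vertex x y z) && (u == None :> T_vertex x y z).
  rewrite /adj /= /sym_closure /That_parent /= orbACA; congr orb.
  by rewrite [X in _ || X]andbC orbb.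
rewrite nbsumE; transitivity (\sum_(u : T_vertex x y z)
    (@adj (T_graph x y z) v u * level_fun (a, b, c, d) u +
     (None == u) * ((v == None :> T_vertex x y z) * a))).
  apply: eq_bigr => u _; rewrite adjE.
  by case: v {adjE} => [?|]; case: u => [?|] //=; rewrite ?orbF ?muln0 ?addn0 ?mul1n.
rewrite big_split /= -(nbsumE (H := T_graph x y z)) nbsum_T.
rewrite (bigD1 None) //= big1 ?addn0 => [|[]//].
by case: v {adjE} => [[i [[j [k|]]|]]|] /=; lia.
Qed.

(** The number [l] of loops at the root is 0 for [T_graph] and 1 for [That_graph]. *)
Definition level_step l x y z (q : nat * nat * nat * nat) :=
  let '(a, b, c, d) := q in (l * a + x * b, a + y * c, b + z * d, c).

Lemma walks_T x y z k (v : T_graph x y z) :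
  walks k v = @level_fun x y z (iter k (level_step 0 x y z) (1, 1, 1, 1)) v.
Proof.
elim: k v => [|k IHk] v; first by case: v => [[i [[j [o|]]|]]|].
rewrite iterS; case: (iter k _ _) IHk => [[[a b] c] d] IHk.
rewrite /level_step mul0n add0n -nbsum_T; apply: eq_bigr => u _; exact: IHk.
Qed.

Lemma walks_That x y z k (v : That_graph x y z) :
  walks k v = @level_fun x y z (iter k (level_step 1 x y z) (1, 1, 1, 1)) v.
Proof.
elim: k v => [|k IHk] v; first by case: v => [[i [[j [o|]]|]]|].
rewrite iterS; case: (iter k _ _) IHk => [[[a b] c] d] IHk.
rewrite /level_step mul1n -nbsum_That; apply: eq_bigr => u _; exact: IHk.
Qed.

(** * The gap as an integer linear form in the walk vector, and its sign for [T_graph 7 1 9] *)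

Notation Z4 := (Z * Z * Z * Z)%type.

Definition Z4_of_nat (q : nat * nat * nat * nat) : Z4 :=
  let '(a, b, c, d) := q in (Z.of_nat a, Z.of_nat b, Z.of_nat c, Z.of_nat d).

Definition Zstep (l x y z : Z) (w : Z4) : Z4 :=
  let '(a, b, c, d) := w in (l * a + x * b, a + y * c, b + z * d, c)%Z.

(** The transpose of the matrix of [Zstep], acting on linear forms. *)
Definition Zstep_dual (l x y z : Z) (f : Z4) : Z4 :=
  let '(p, q, r, s) := f in (l * p + q, x * p + r, y * q + s, z * r)%Z.

Definition dot (f w : Z4) : Z :=
  let '(p, q, r, s) := f in let '(a, b, c, d) := w in
  (p * a + q * b + r * c + s * d)%Z.

Definition pos4 (w : Z4) : Prop :=
  let '(a, b, c, d) := w in [/\ 0 < a, 0 < b, 0 < c & 0 < d]%Z.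

Definition Zwalks (l x y z : nat) (k : nat) : Z4 :=
  iter k (Zstep (Z.of_nat l) (Z.of_nat x) (Z.of_nat y) (Z.of_nat z)) (1, 1, 1, 1)%Z.

Lemma Z4_of_nat_iter l x y z k :
  Z4_of_nat (iter k (level_step l x y z) (1, 1, 1, 1)) = Zwalks l x y z k.
Proof.
elim: k => // k IHk; rewrite /Zwalks !iterS -/(Zwalks l x y z k) -IHk.
by case: (iter k _ _) => [[[a b] c] d] /=; congr (_, _, _, _); lia.
Qed.

(** Per level, the size of the level (1, [x], [x * y], [x * y * z]) times the common value of W_3 -
    W_1 W_2. *)
Definition gap_form (l x y z : nat) : Z4 :=
  let '(a1, b1, c1, d1) := Zwalks l x y z 1 in
  let '(a2, b2, c2, d2) := Zwalks l x y z 2 in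
  let '(a3, b3, c3, d3) := Zwalks l x y z 3 in
  (a3 - a1 * a2, Z.of_nat x * (b3 - b1 * b2),
   Z.of_nat x * Z.of_nat y * (c3 - c1 * c2),
   Z.of_nat x * Z.of_nat y * Z.of_nat z * (d3 - d1 * d2))%Z.

Lemma hom_path_add4 (H : graph) n :
  hom (path_graph n.+4) H = \sum_(v : H) walks n v * walks 3 v.
Proof.
by rewrite hom_path sum_walks_iter /walks -iterD addnC.
Qed.

Lemma hom_gap l x y z (r : rel (T_vertex x y z)) n :
  (forall k (v : sym_graph r),
     walks k v = @level_fun x y z (iter k (level_step l x y z) (1, 1, 1, 1)) v) ->
  (Z.of_nat (hom (path_graph n.+4) (sym_graph r))
   - Z.of_nat (hom (E_graph n.+4) (sym_graph r))
   = dot (gap_form l x y z) (Zwalks l x y z n))%Z.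
Proof.
move=> walksE; rewrite hom_path_add4 hom_E.
under eq_bigr do rewrite !walksE.
under [X in (_ - Z.of_nat X)%Z]eq_bigr do rewrite !walksE.
rewrite /gap_form -!Z4_of_nat_iter.
case: (iter n _ _) => [[[a b] c] d]; case: (iter 1 _ _) => [[[a1 b1] c1] d1].
case: (iter 2 _ _) => [[[a2 b2] c2] d2]; case: (iter 3 _ _) => [[[a3 b3] c3] d3].
rewrite (eq_bigr (@level_fun x y z (a * a3, b * b3, c * c3, d * d3))); last first.
  by case=> [[i [[j [k|]]|]]|].
rewrite [in X in (_ - X)%Z](eq_bigr (@level_fun x y z
   (a * (a1 * a2), b * (b1 * b2), c * (c1 * c2), d * (d1 * d2)))); last first.
  by case=> [[i [[j [k|]]|]]|].
by rewrite !sum_level_fun /=; lia.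
Qed.

Lemma hom_E_lt_path_T x y z n :
  (0 < dot (gap_form 0 x y z) (Zwalks 0 x y z n))%Z ->
  hom (E_graph n.+4) (T_graph x y z) < hom (path_graph n.+4) (T_graph x y z).
Proof. by rewrite -(hom_gap n (@walks_T x y z)) -/(T_graph x y z); lia. Qed.

Lemma hom_E_lt_path_That x y z n :
  (0 < dot (gap_form 1 x y z) (Zwalks 1 x y z n))%Z ->
  hom (E_graph n.+4) (That_graph x y z) < hom (path_graph n.+4) (That_graph x y z).
Proof. by rewrite -(hom_gap n (@walks_That x y z)) -/(That_graph x y z); lia. Qed.

(* The two-step matrix on either colour class has characteristic polynomial
   t^2 - 17 t + 63, whose larger root exceeds 11. *)
Lemma gap_T_pos j : (0 < dot (gap_form 0 7 1 9) (Zwalks 0 7 1 9 (j.*2 + 9)))%Z.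
Proof.
have -> : gap_form 0 7 1 9 = (21, -63, -21, 63)%Z by vm_compute.
(* Positivity alone is not inductive. For g'' = 17 g' - 63 g, the bound g' >= 11 g gives g'' - 11 g'
   = 6 g' - 63 g >= 3 g > 0. *)
suff [] : (0 < dot (21, -63, -21, 63) (Zwalks 0 7 1 9 (j.*2 + 9)))%Z /\
   (11 * dot (21, -63, -21, 63) (Zwalks 0 7 1 9 (j.*2 + 9)) <=
    dot (21, -63, -21, 63) (Zwalks 0 7 1 9 (j.*2 + 9).+2))%Z by [].
elim: j => [|j IHj]; first by split; vm_compute.
rewrite doubleS !addSn; move: IHj; rewrite /Zwalks !iterS.
case: (iter _ _ _) => [[[a b] c] d]; rewrite /Zstep /dot.
by change (Z.of_nat 0) with 0%Z; change (Z.of_nat 7) with 7%Z; lia.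
Qed.

(** * Sign certificate for the looped tree by rounded dual iteration *)

Definition round4 (f : Z4) : Z4 :=
  let '(p, q, r, s) := f in
  if (Z.abs p <? 2 ^ 48)%Z then f
  else (Z.shiftr p 20, Z.shiftr q 20, Z.shiftr r 20, Z.shiftr s 20).

(** The shift is a floor division by 2^20, also for negative coefficients, so on a positive vector
    2^20 times the rounded value is at most the true one. Rounding keeps the integers short over
    thousands of steps. *)
Lemma dot_round4 f w : pos4 w -> (0 < dot (round4 f) w)%Z -> (0 < dot f w)%Z.
Proof.
case: f => [[[p q] r] s]; case: w => [[[a b] c] d] [a0 b0 c0 d0].
rewrite /round4; case: (_ <? _)%Z; first by [].
rewrite /dot !Z.shiftr_div_pow2; try by [].
have le t e : (0 < e)%Z -> (2 ^ 20 * (t / 2 ^ 20 * e) <= t * e)%Z.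
  move=> e0; rewrite Z.mul_assoc; apply: Z.mul_le_mono_nonneg_r; first by lia.
  exact: Z.mul_div_le.
by have := le p a a0; have := le q b b0; have := le r c c0; have := le s d d0; lia.
Qed.

Lemma dot_Zstep l x y z f w :
  dot f (Zstep l x y z w) = dot (Zstep_dual l x y z f) w.
Proof. by case: f => [[[p q] r] s]; case: w => [[[a b] c] d] /=; ring. Qed.

Lemma pos4_iter_Zstep l x y z k w :
  (0 <= l)%Z -> (0 < x)%Z -> (0 <= y)%Z -> (0 <= z)%Z ->
  pos4 w -> pos4 (iter k (Zstep l x y z) w).
Proof.
move=> l0 x0 y0 z0 w0; elim: k => //= k.
case: (iter _ _ _) => [[[a b] c] d] [*]; rewrite /Zstep /pos4; split; nia.
Qed.

(** The steps pass one by one from the vector to the form, with a rounding after each. The binary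
    counter of [N.iter] lets the form be computed for large [k]. *)
Lemma dot_iter_Zstep l x y z k f w :
  (0 <= l)%Z -> (0 < x)%Z -> (0 <= y)%Z -> (0 <= z)%Z -> pos4 w ->
  (0 < dot (N.iter k (fun f => round4 (Zstep_dual l x y z f)) f) w)%Z ->
  (0 < dot f (iter (N.to_nat k) (Zstep l x y z) w))%Z.
Proof.
move=> l0 x0 y0 z0 w0; elim/N.peano_ind: k f => [//|k IHk] f.
rewrite N.iter_succ_r Nnat.N2Nat.inj_succ iterS dot_Zstep => /IHk.
exact/dot_round4/pos4_iter_Zstep.
Qed.

(* The two dominant eigenvalues, about 28.393 and -28.386, are so close in
   modulus that the gap settles its sign only after some 11000 steps. *)
Lemma gap_That_pos n : (N.to_nat 12000 <= n) ->
  (0 < dot (gap_form 1 400 3 800) (Zwalks 1 400 3 800 n))%Z.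
Proof.
(* The first [n - 12000] steps only need to keep the vector positive; the last 12000 are transferred
   to the form. *)
move=> len; rewrite -(subnKC len) /Zwalks iterD.
have w0 : pos4 (iter (n - N.to_nat 12000) (Zstep 1 400 3 800) (1, 1, 1, 1)%Z).
  by apply: pos4_iter_Zstep; last split.
apply: dot_iter_Zstep; [by [] | by [] | by [] | by [] | exact: w0 |].
(* By direct computation, all four coefficients of the rounded form end up positive, hence so is its
   value on any positive vector. *)
have : pos4 (N.iter 12000 (fun f => round4 (Zstep_dual 1 400 3 800 f))
               (gap_form 1 400 3 800)) by vm_compute; split.
move: w0; case: (iter _ _ _) => [[[a b] c] d] [a0 b0 c0 d0].
case: (N.iter _ _ _) => [[[p q] r] s] [p0 q0 r0 s0].
by rewrite /dot; do !apply: Z.add_pos_pos; exact: Z.mul_pos_pos.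
Qed.

Theorem theorem1p4 :
  (exists N : nat, forall n : nat, N <= n -> odd n ->
     hom (E_graph n) (T_graph 7 1 9) < hom (path_graph n) (T_graph 7 1 9))
  /\ (exists N : nat, forall n : nat, N <= n ->
     hom (E_graph n) (That_graph 400 3 800)
     < hom (path_graph n) (That_graph 400 3 800))
  /\ (exists N : nat, forall n : nat, N <= n -> odd n ->
     Leontovich_at (T_graph 7 1 9) n)
  /\ strongly_Leontovich (That_graph 400 3 800).
Proof.
have ltT n : 13 <= n -> odd n ->
    hom (E_graph n) (T_graph 7 1 9) < hom (path_graph n) (T_graph 7 1 9).
  (* The threshold 13 is the starting exponent 9 plus the shift by 4 between exponent and order. *)
  move=> le13 oddn; have -> : n = (((n - 13)./2).*2 + 9).+4.
    by rewrite even_halfK ?oddB ?oddn //; lia.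
  exact/hom_E_lt_path_T/gap_T_pos.
have ltThat n : (N.to_nat 12000).+4 <= n ->
    hom (E_graph n) (That_graph 400 3 800)
    < hom (path_graph n) (That_graph 400 3 800).
  case: n => [|[|[|[|n]]]] // len.
  exact/hom_E_lt_path_That/gap_That_pos.
have Leon H n : 4 <= n -> hom (E_graph n) H < hom (path_graph n) H ->
    Leontovich_at H n.
  case: n => [|[|[|[|n]]]] // _ lt; exists (E_graph n.+4).
  by split=> //; [exact: E_graph_tree | exact: card_ord].
split; first by exists 13.
split; first by exists (N.to_nat 12000).+4.
split; first by exists 13 => n le13 oddn; apply: Leon (ltT n le13 oddn); lia.
exists (N.to_nat 12000).+4 => n len; apply: Leon (ltThat n len).
by case: n len => [|[|[|[|n]]]].
Qed.
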